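(* Let $m\ge3$ be an odd integer. Let $X$ be a centered Gaussian process on $[0,1]$ with covariance $Q(u,v)=\mathbf{E}[X_uX_v]$, variance $Q_u:=Q(u,u)=Var[X_u]$, and canonical metric $\delta^2(s,t)=\mathbf{E}[(X_t-X_s)^2]$. Assume: (1) there exists a univariate increasing and concave function $\delta^2$ such that $\delta(r)=o(r^{1/(2m)})$ for $r$ near $0$ and $\delta^2(s,t)\le\delta^2(|t-s|)$ for all $s,t$; (2) in the sense of distributions, the mixed derivative $\partial^2\delta^2/(\partial s\,\partial t)$ of the bivariate function $(s,t)\mapsto\delta^2(s,t)$ is a signed $\sigma$-finite measure $\mu$ on $[0,1]^2$ minus the diagonal $\{(s,s):s\in[0,1]\}$, whose total variation measure $|\mu|$ satisfies, for some constant $C$ and all $\varepsilon>0$ small enough, $|\mu|\left(\{(s,t):0\le s\le t-\varepsilon\le1\}\right)\le C\varepsilon^{-(m-1)/m}$; (3) for $u<v$, the functions $u\mapsto Q_u$, $v\mapsto\delta^2(u,v)$, and $u\mapsto-\delta^2(u,v)$ are increasing and concave; (4) there exist positive constants $a>1$, $b<1/2$, $c>1/4$ and $c'>0$ such that for all $\varepsilon<u<v\le1$: (i) $c\,\delta^2(u)\le Q_u$; (ii) $c'\,\delta^2(u)\,\delta^2(v-u)\le Q_uQ_v-Q^2(u,v)$; (iii) $\displaystyle\frac{\delta(au)-\delta(u)}{(a-1)u}<b\,\frac{\delta(u)}{u}$. Then for every bounded measurable function $g$ on $\mathbf{R}$, $$\lim_{\varepsilon\to0}\frac1{\varepsilon^2}\mathbf{E}\left[\left(\int_0^1\left(X_{u+\varepsilon}-X_u\right)^m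 g\left(\frac{X_{u+\varepsilon}+X_u}{2}\right)du\right)^2\right]=0.$$
   Context: The same symbol $\delta^2$ denotes both the bivariate canonical metric squared, $\delta^2(s,t)$, and the univariate function $\delta^2(r)$ of (1), which is the square of a non-negative function $\delta$ and is understood to be defined at all arguments that appear. In (4), $\varepsilon>0$ is the regularization parameter that tends to $0$ in the conclusion, and $a,b,c,c'$ are constants not depending on it. The process $X$ is understood to be defined at the times $u+\varepsilon$ slightly beyond $1$ that appear in the conclusion. *)

(* Defs.v *)
From HB Require Import structures.
From mathcomp Require Export all_boot all_order all_algebra.
From mathcomp Require Export all_classical all_reals all_analysis.

Set Implicit Arguments.
Unset Strict Implicit.
Unset Printing Implicit Defensive.

Export Order.TTheory GRing.Theory Num.Theory.
Export numFieldNormedType.Exports.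

Local Open Scope classical_set_scope.
Local Open Scope ring_scope.

Section monotone_concave.
Context {R : realType}.

Definition concave_on (D : set R) (f : R -> R) : Prop :=
  convex_function (D : set R^o) (fun x => - f x).

(* "Increasing" is meant in the wide sense. *)
Definition increasing_concave (D : set R) (f : R -> R) : Prop :=
  {in D &, {homo f : x y / x <= y}} /\ concave_on D f.

End monotone_concave.

Section gaussian_processes.
Context {d : measure_display} {T : measurableType d} {R : realType}.
Variable P : probability T R.

(* The library's [normal_prob m 0] is a uniform law, not the point mass at [m],
   so the degenerate case is treated separately. *)
Definition gaussian_variable (Y : T -> R) : Prop :=
  exists m s : R, forall A : set R, measurable A ->
    P (Y @^-1` A) = if s == 0 then \d_m A else normal_prob m s A.

Definition gaussian_process (I : set R) (X : R -> T -> R) : Prop :=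
  forall (n : nat) (t a : 'I_n -> R), (forall i, I (t i)) ->
    gaussian_variable (fun w => \sum_(i < n) a i * X (t i) w).

Definition centered (I : set R) (X : R -> T -> R) : Prop :=
  forall t, I t -> 'E_P[X t]%E = 0%E.

Definition cov_fun (X : R -> T -> R) (u v : R) : R :=
  fine 'E_P[(fun w => X u w * X v w)%R]%E.

Definition canonical_metric2 (X : R -> T -> R) (s t : R) : R :=
  fine 'E_P[(fun w => (X t w - X s w) ^+ 2)%R]%E.

End gaussian_processes.

Section signed_measures.
Context {R : realType}.
Let plane := (measurableTypeR R * measurableTypeR R)%type.

(* A signed sigma-finite measure cannot be a set function when its positive and
   negative parts are both infinite; it is given by its Jordan decomposition. *)
Record signed_measure := SignedMeasure {
  pos_part : {sigma_finite_measure set plane -> \bar R} ;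
  neg_part : {sigma_finite_measure set plane -> \bar R} ;
  parts_singular : exists N : set plane,
    [/\ measurable N, pos_part N = 0%E & neg_part (~` N) = 0%E] }.

Definition total_variation (mu : signed_measure) (A : set plane) : \bar R :=
  (pos_part mu A + neg_part mu A)%E.

End signed_measures.

Section distributions.
Context {R : realType}.
Implicit Types (phi : R * R -> R) (U : set (R * R)).

Definition e1 : R * R := (1, 0).
Definition e2 : R * R := (0, 1).

(* [phi] has iterated directional derivatives of all orders, all continuous. *)
Definition smooth phi : Prop :=
  forall ds : seq (R * R),
    let psi := foldr (fun v f => 'D_v f) phi ds in
    continuous psi /\ forall z v, derivable psi z v.

Definition test_function U phi : Prop :=
  smooth phi /\
  exists K : set (R * R),
    [/\ compact K, K `<=` U & forall z, ~ K z -> phi z = 0].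

(* The second mixed derivative of [F] on the open set [U] is [mu] in the sense
   of distributions; integrability of the test functions says that [mu] is
   locally finite, i.e. that it does define a distribution. *)
Definition mixed_derivative_is U (F : R -> R -> R) (mu : @signed_measure R)
    : Prop :=
  forall phi, test_function U phi ->
    [/\ (pos_part mu).-integrable U (EFin \o phi),
        (neg_part mu).-integrable U (EFin \o phi) &
        (\int[lebesgue_measure \x lebesgue_measure]_(z in U)
            (F z.1 z.2 * 'D_e1 ('D_e2 phi) z)%:E
         = \int[pos_part mu]_(z in U) (phi z)%:E
           - \int[neg_part mu]_(z in U) (phi z)%:E)%E].

Definition offdiag_square : set (R * R) :=
  [set z | [/\ 0 <= z.1 <= 1, 0 <= z.2 <= 1 & z.1 != z.2]].

Definition open_offdiag_square : set (R * R) :=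
  [set z | [/\ 0 < z.1 < 1, 0 < z.2 < 1 & z.1 != z.2]].

Definition gap_region (eps : R) : set (R * R) :=
  [set z | [/\ 0 <= z.1, z.1 <= z.2 - eps & z.2 - eps <= 1]].

End distributions.

(* Main.v *)
(* As u |-> - delta^2(u, v) is concave on [0, v[ and tends to 0 at v, comparison
   with the chord from 0 gives
     delta^2(u, v) <= (1 - u / v) delta^2(0, v) <= C (v - u) v^(1/m - 1).
   With v = u + e, the variance of X_(u+e) - X_u is thus at most both e^(1/m)
   and C e (u + e)^(1/m - 1) (away from the end point u = 1), so that its power
   m/2, up to a constant the L^2 norm of (X_(u+e) - X_u)^m, is at most
   e^((m-2)/(2m)) C e (u + e)^(1/m - 1).  Its integral over u in [0, 1] is
   O(e^(1 + 1/(2m))) since m >= 3, and the second moment of the integral over u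
   is O(e^(2 + 1/m)) = o(e^2). *)
Require Import Defs.
From mathcomp Require Import measurable_realfun ring lra.

Set Implicit Arguments.
Unset Strict Implicit.
Unset Printing Implicit Defensive.

Local Open Scope classical_set_scope.
Local Open Scope ring_scope.

(** * Gaussian moments *)

Section normal_moments.
Context {R : realType}.
Implicit Types (a s : R) (k : nat).
Local Notation leb := (@lebesgue_measure R).

(** The Radon-Nikodym derivative of [normal_prob a s] and the explicit density [normal_pdf a s] have
    the same integral over every measurable set. They agree almost everywhere, so the change of
    variables can be written with the latter. *)
Lemma ge0_integral_normal_prob a s (f : R -> \bar R) :
  measurable_fun [set: R] f -> (forall x, 0 <= f x)%E ->
  (\int[normal_prob a s]_x f x =
   \int[leb]_x (f x * (normal_pdf a s x)%:E))%E.
Proof.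
move=> mf f0; have dom := @normal_prob_dominates R a s.
rewrite -(Radon_Nikodym_SigmaFinite.change_of_variables dom)//.
have mpdf : measurable_fun [set: R] (EFin \o normal_pdf a s).
  by apply/measurable_EFinP; exact: measurable_normal_pdf.
have mRN : measurable_fun [set: R]
    (Radon_Nikodym_SigmaFinite.f (normal_prob a s) leb).
  exact: measurable_int (Radon_Nikodym_SigmaFinite.f_integrable dom).
apply: ae_eq_integral => //.
- exact: emeasurable_funM.
- exact: emeasurable_funM.
- apply: ae_eqe_mul2l; apply: integral_ae_eq => //.
  + exact: Radon_Nikodym_SigmaFinite.f_integrable.
  + by move=> E _ mE; rewrite -Radon_Nikodym_SigmaFinite.f_integral.
Qed.

Lemma normal_peakZ a s : 0 < a -> normal_peak (a * s) = a^-1 * normal_peak s.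
Proof.
move=> a0; rewrite /normal_peak exprMn -mulrA -mulrnAr sqrtrM ?sqr_ge0//.
by rewrite sqrtr_sqr gtr0_norm// invfM.
Qed.

(** As -1/2 + 3/8 = -1/8, the exponential turns the density of scale [s] into twice the density of
    scale [2 * s]. *)
Lemma normal_exp_square_moment a s : s != 0 ->
  (\int[normal_prob a s]_x
     (expR (3 / 8 * (x - a) ^+ 2 / s ^+ 2))%:E = 2%:E)%E.
Proof.
move=> s0; have s20 : 2 * s != 0 by rewrite mulf_neq0.
rewrite ge0_integral_normal_prob//; last first.
  apply/measurable_EFinP/measurableT_comp => //.
  do 2 apply: measurable_funM => //.
  by apply: measurable_funX; exact: measurable_funB.
transitivity (\int[leb]_x (2%:E * (normal_pdf a (2 * s) x)%:E))%E.
  apply: eq_integral => x _; rewrite -!EFinM !normal_pdfE//; congr (_%:E).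
  rewrite normal_peakZ// mulrCA -[in RHS]mulrA mulVKf//; congr (_ * _).
  by rewrite -expRD; congr expR; field.
rewrite integralZl//; last exact: integrable_normal_pdf.
by rewrite integral_normal_pdf mule1.
Qed.

(** Compare t^k <= k! exp(t) at t = 3/8 (x - a)^2 / s^2, and integrate: the exponential moment
    equals 2. *)
Lemma normal_centered_moment_le a s k : s != 0 ->
  (\int[normal_prob a s]_x (((x - a) ^+ 2) ^+ k)%:E <=
   (2 * k`!%:R * (8 / 3) ^+ k * (s ^+ 2) ^+ k)%:E)%E.
Proof.
move=> s0; pose c : R := k`!%:R * (8 / 3) ^+ k * (s ^+ 2) ^+ k.
have c0 : 0 <= c.
  by rewrite /c !(sqr_ge0, exprn_ge0, invr_ge0, mulr_ge0).
have mx : measurable_fun [set: R] (fun x => (x - a) ^+ 2).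
  by apply: measurable_funX; exact: measurable_funB.
have mexp : measurable_fun [set: R]
    (fun x => (expR (3 / 8 * (x - a) ^+ 2 / s ^+ 2))%:E).
  apply/measurable_EFinP/measurableT_comp => //.
  by do 2 apply: measurable_funM => //.
apply: (@le_trans _ _ (\int[normal_prob a s]_x
    (c%:E * (expR (3 / 8 * (x - a) ^+ 2 / s ^+ 2))%:E)))%E.
  apply: ge0_le_integral => //.
  - by move=> x _; rewrite lee_fin exprn_ge0// sqr_ge0.
  - by apply/measurable_EFinP/measurable_funX.
  - exact: emeasurable_funM.
  - move=> x _; rewrite -EFinM lee_fin.
    set t := 3 / 8 * (x - a) ^+ 2 / s ^+ 2.
    have -> : (x - a) ^+ 2 = 8 / 3 * t * s ^+ 2 by rewrite /t; field.
    have t0 : 0 <= t by rewrite /t !(sqr_ge0, exprn_ge0, invr_ge0, mulr_ge0).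
    rewrite [leLHS](_ : _ = (8 / 3) ^+ k * (s ^+ 2) ^+ k * t ^+ k); last first.
      by rewrite mulrAC !(exprMn _ (_ * _)) exprMn.
    rewrite [leRHS](_ : _ = (8 / 3) ^+ k * (s ^+ 2) ^+ k * (k`!%:R * expR t));
      last by rewrite /c; ring.
    rewrite ler_wpM2l ?(sqr_ge0, exprn_ge0, invr_ge0, mulr_ge0)//.
    case: k {c c0} => [|k].
      by rewrite expr0 mul1r -[leLHS]expR0 ler_expR.
    rewrite mulrC -ler_pdivrMr ?ltr0n ?fact_gt0//.
    by apply: le_trans (expR_ge1Dxn k t0); rewrite lerDr.
rewrite ge0_integralZl//.
by rewrite normal_exp_square_moment// -EFinM lee_fin /c mulrC !mulrA.
Qed.

(* Integrate 1 <= t + exp (- t) at t = 3 x^2 / (2 s^2): tilting the density by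
   exp (- t) gives at most half the density of standard deviation s / 2. *)
Lemma normal_scale_le_second_moment a s : s != 0 ->
  ((s ^+ 2)%:E <= 3%:E * \int[normal_prob a s]_x (x ^+ 2)%:E)%E.
Proof.
move=> s0; have s20 : 2^-1 * s != 0 by rewrite mulf_neq0// invr_neq0.
have ss0 : 0 < s ^+ 2 by rewrite exprn_even_gt0.
pose e x := expR (- (3 / 2 * x ^+ 2 / s ^+ 2)).
have me : measurable_fun [set: R] (EFin \o e).
  apply/measurable_EFinP/measurableT_comp => //.
  apply: measurableT_comp => //.
  by do 2 apply: measurable_funM => //; exact: measurable_funX.
have mx2 : measurable_fun [set: R] (fun x : R => (x ^+ 2)%:E).
  by apply/measurable_EFinP; exact: measurable_funX.
have me_le : (\int[normal_prob a s]_x (e x)%:E <= (2^-1)%:E)%E.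
  rewrite ge0_integral_normal_prob//; last first.
    by move=> x; rewrite lee_fin expR_ge0.
  have mpdf b : measurable_fun [set: R] (fun x => (normal_pdf a b x)%:E).
    by apply/measurable_EFinP; exact: measurable_normal_pdf.
  apply: (@le_trans _ _
     (\int[leb]_x ((2^-1)%:E * (normal_pdf (a / 4) (2^-1 * s) x)%:E))%E).
    apply: ge0_le_integral => //.
    - by move=> x _; rewrite -EFinM lee_fin mulr_ge0 ?expR_ge0 ?normal_pdf_ge0.
    - by apply: emeasurable_funM => //; exact: mpdf.
    - apply: emeasurable_funM => //; apply/measurable_EFinP.
      exact: measurable_normal_pdf.
    - move=> x _; rewrite -!EFinM lee_fin !normal_pdfE// normal_peakZ//.
      rewrite mulrCA -[in leRHS]mulrA mulVKf ?invr_neq0//.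
      rewrite ler_wpM2l ?normal_peak_ge0//.
      rewrite /e /normal_fun -expRD ler_expR.
      (* Completing the square, 3 x^2 + (x - a)^2 = 4 (x - a/4)^2 + 3/4 a^2. Hence the mean [a / 4];
         the leftover term only lowers the integrand. *)
      rewrite -subr_ge0.
      rewrite (_ : _ - _ = 3 / 8 * a ^+ 2 / s ^+ 2); last by field.
      by rewrite !(sqr_ge0, exprn_ge0, invr_ge0, mulr_ge0).
  rewrite integralZl//; last exact: integrable_normal_pdf.
  by rewrite integral_normal_pdf mule1.
have I0 : (0 <= \int[normal_prob a s]_x (x ^+ 2)%:E)%E.
  by apply: integral_ge0 => x _; rewrite lee_fin sqr_ge0.
have : (1 <= (3 / 2 / s ^+ 2)%:E * \int[normal_prob a s]_x (x ^+ 2)%:E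
             + (2^-1)%:E)%E.
  apply: le_trans (leeD2l _ me_le).
  rewrite -ge0_integralZl//; last 2 first.
  - by move=> x _; rewrite lee_fin sqr_ge0.
  - by rewrite lee_fin !(sqr_ge0, exprn_ge0, invr_ge0, mulr_ge0).
  rewrite -ge0_integralD//; last 3 first.
  - by move=> x _; rewrite -EFinM lee_fin !(sqr_ge0, exprn_ge0, invr_ge0, mulr_ge0).
  - exact: emeasurable_funM.
  - by move=> x _; rewrite lee_fin expR_ge0.
  rewrite -[leLHS](probability_setT (normal_prob a s)) -[leLHS]mul1e.
  rewrite -integral_cst//; apply: ge0_le_integral => //.
  - by apply: emeasurable_funD => //; exact: emeasurable_funM.
  - move=> x _; rewrite -EFinM -EFinD lee_fin /e.
    have := expR_ge1Dx (- (3 / 2 * x ^+ 2 / s ^+ 2)).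
    by rewrite mulrAC; lra.
case: (\int[_]_x _)%E I0 => [q| |]//=.
  rewrite -!EFinM -EFinD !lee_fin => q0 h.
  have : 2^-1 <= 3 / 2 / s ^+ 2 * q by lra.
  rewrite mulrAC ler_pdivlMr//; lra.
by move=> _ _; rewrite gt0_muley ?leey// lte_fin.
Qed.

End normal_moments.

(** * Even moments of a Gaussian variable in terms of its second moment *)

Section gaussian_moments.
Context {R : realType}.
Implicit Types (a s : R) (k : nat).

Lemma exprD_le2 (x y : R) k : 0 <= x -> 0 <= y ->
  (x + y) ^+ k <= 2 ^+ k * (x ^+ k + y ^+ k).
Proof.
move=> x0 y0; wlog xy : x y x0 y0 / x <= y => [H|].
  have [|/ltW] := leP x y; first exact: H.
  by rewrite addrC [X in _ * X]addrC; exact: H.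
apply: (@le_trans _ _ ((2 * y) ^+ k)).
  by rewrite lerXn2r ?nnegrE ?addr_ge0 ?mulr_ge0// mulr_natl mulr2n lerD2r.
by rewrite exprMn ler_wpM2l ?exprn_ge0// lerDr exprn_ge0.
Qed.

(** The factor [4 ^+ k] comes from splitting x^2 around the mean. With q the second moment, 8 is 8/3
    times the 3 of s^2 <= 3 q, and 34 is the constant of a^2 <= 34 q. *)
Definition moment_const k : R := 4 ^+ k * (2 * k`!%:R * 8 ^+ k + 34 ^+ k).

Lemma moment_const_ge1 k : 1 <= moment_const k.
Proof.
rewrite /moment_const; apply: mulr_ege1; first by rewrite exprn_ege1// ler1n.
apply: ler_wpDl; last by rewrite exprn_ege1// ler1n.
by rewrite !(exprn_ge0, mulr_ge0).
Qed.

(** Splitting x^2 <= 2 (x - a)^2 + 2 a^2 leaves a centred moment of size (s^2)^k and the constant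
    (a^2)^k. Both s^2 and a^2 are then bounded by multiples of the second moment. *)
Lemma normal_moment_le a s k : s != 0 ->
  (\int[normal_prob a s]_x ((x ^+ 2) ^+ k)%:E <=
   (moment_const k * fine (\int[normal_prob a s]_x (x ^+ 2)%:E) ^+ k)%:E)%E.
Proof.
move=> s0; set q := (\int[normal_prob a s]_x (x ^+ 2)%:E)%E.
have mX n b : measurable_fun [set: R] (fun x => (((x - b) ^+ 2) ^+ n)%:E).
  apply/measurable_EFinP/measurable_funX/measurable_funX.
  exact: measurable_funB.
have mX0 n : measurable_fun [set: R] (fun x : R => ((x ^+ 2) ^+ n)%:E).
  by apply/measurable_EFinP; do 2 apply: measurable_funX.
have int_cst c : (\int[normal_prob a s]_x c%:E = c%:E)%E.
  rewrite integral_cst// -[RHS]mule1; congr (_ * _)%E.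
  exact: probability_setT.
have mom n : (\int[normal_prob a s]_x ((x ^+ 2) ^+ n)%:E <=
    (4 ^+ n * (2 * n`!%:R * (8 / 3) ^+ n * (s ^+ 2) ^+ n
               + (a ^+ 2) ^+ n))%:E)%E.
  apply: (@le_trans _ _ (\int[normal_prob a s]_x
      ((4 ^+ n)%:E * ((((x - a) ^+ 2) ^+ n)%:E + ((a ^+ 2) ^+ n)%:E))))%E.
    apply: ge0_le_integral => //.
    - by move=> x _; rewrite lee_fin !(sqr_ge0, exprn_ge0).
    - exact: mX0.
    - by apply: emeasurable_funM => //; apply: emeasurable_funD => //; exact: mX.
    - move=> x _; rewrite -EFinD -EFinM lee_fin.
      apply: (@le_trans _ _ ((2 * (x - a) ^+ 2 + 2 * a ^+ 2) ^+ n)).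
        rewrite lerXn2r ?nnegrE ?(sqr_ge0, addr_ge0, mulr_ge0)//.
        by have := sqr_ge0 (x - 2 * a); nra.
      rewrite (_ : (4 : R) = 2 * 2); last by ring.
      rewrite -mulrDr (exprMn _ 2 2) (exprMn _ 2) -mulrA.
      by rewrite ler_wpM2l ?exprn_ge0// exprD_le2// sqr_ge0.
  rewrite ge0_integralZl//; last 2 first.
  - by apply: emeasurable_funD => //; exact: mX.
  - by move=> x _; rewrite -EFinD lee_fin ?(sqr_ge0, exprn_ge0, addr_ge0).
  rewrite ge0_integralD//; last 3 first.
  - by move=> x _; rewrite lee_fin exprn_ge0 ?sqr_ge0.
  - exact: mX.
  - by move=> x _; rewrite lee_fin exprn_ge0 ?sqr_ge0.
  rewrite int_cst EFinM lee_pmul2l ?lte_fin ?exprn_gt0//.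
  by rewrite EFinD leeD2r// normal_centered_moment_le.
have qfin : q \is a fin_num.
  rewrite ge0_fin_numE; last first.
    by apply: integral_ge0 => x _; rewrite lee_fin sqr_ge0.
  apply: le_lt_trans (mom 1%N) _; exact: ltry.
have q_ge0 : (0 <= fine q)%R.
  by rewrite fine_ge0//; apply: integral_ge0 => x _; rewrite lee_fin sqr_ge0.
have sq : s ^+ 2 <= 3 * fine q.
  rewrite -lee_fin (EFinM 3) fineK//; exact: normal_scale_le_second_moment.
(* Integrating a^2 <= 2 x^2 + 2 (x - a)^2, with the centred bound for k = 1, gives 2 q + 32/3 s^2,
   which is at most 2 q + 32 q. *)
have aq : a ^+ 2 <= 34 * fine q.
  suff : a ^+ 2 <= 2 * fine q + 2 * (2 * 1`!%:R * (8 / 3) ^+ 1 * (s ^+ 2) ^+ 1).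
    by rewrite !expr1 (_ : 1`! = 1%N)//; lra.
  rewrite -lee_fin EFinD !(EFinM 2) fineK// -(int_cst (a ^+ 2)).
  apply: (@le_trans _ _ (\int[normal_prob a s]_x
      (2%:E * (x ^+ 2)%:E + 2%:E * (((x - a) ^+ 2) ^+ 1)%:E)))%E.
    apply: ge0_le_integral => //.
    - by move=> x _; rewrite lee_fin sqr_ge0.
    - apply: emeasurable_funD; apply: emeasurable_funM => //.
        exact: (mX0 1%N).
      exact: (mX 1%N a).
    - move=> x _; rewrite -!EFinM -EFinD lee_fin expr1.
      by have := sqr_ge0 (2 * x - a); nra.
  rewrite ge0_integralD//; last 4 first.
  - by move=> x _; rewrite -EFinM lee_fin ?(sqr_ge0, mulr_ge0).
  - by apply: emeasurable_funM => //; exact: (mX0 1%N).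
  - by move=> x _; rewrite -EFinM lee_fin expr1 ?(sqr_ge0, mulr_ge0).
  - by apply: emeasurable_funM => //; exact: (mX 1%N a).
  rewrite !ge0_integralZl//; last 4 first.
  - exact: (mX 1%N a).
  - by move=> x _; rewrite lee_fin expr1 sqr_ge0.
  - exact: (mX0 1%N).
  - by move=> x _; rewrite lee_fin sqr_ge0.
  by rewrite leeD2l// lee_pmul2l// normal_centered_moment_le.
apply: le_trans (mom k) _; rewrite lee_fin /moment_const -[leRHS]mulrA.
rewrite ler_wpM2l ?exprn_ge0// [leRHS]mulrDl lerD//.
  rewrite -!mulrA ler_wpM2l// ler_wpM2l// -!exprMn.
  rewrite lerXn2r ?nnegrE ?(sqr_ge0, mulr_ge0, invr_ge0)//.
  by move: sq; lra.
by rewrite -exprMn lerXn2r ?nnegrE ?(sqr_ge0, mulr_ge0).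
Qed.

(** Moments depend on the law alone: a change of variables moves them to a point mass or to a normal
    law. *)
Lemma gaussian_moment_le d (T : measurableType d) (P : probability T R)
    (Y : T -> R) k :
  measurable_fun [set: T] Y -> gaussian_variable P Y ->
  ('E_P[(fun w => (Y w ^+ 2) ^+ k)%R] <=
   (moment_const k * fine 'E_P[(fun w => Y w ^+ 2)%R] ^+ k)%:E)%E.
Proof.
move=> mY [a [s law]]; rewrite unlock.
(* [normal_prob] is a measure on [measurableTypeR R], which carries the same
   sigma-algebra as [R] under another display. *)
pose Z : T -> measurableTypeR R := Y.
have mZ : measurable_fun [set: T] Z by move=> _ A mA; exact: mY.
have mX n : measurable_fun [set: measurableTypeR R]
    (fun x : measurableTypeR R => (((x : R) ^+ 2) ^+ n)%:E).
  by apply/measurable_EFinP; do 2 apply: measurable_funX.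
have X0 n (x : R) : (0 <= ((x ^+ 2) ^+ n)%:E)%E.
  by rewrite lee_fin !(sqr_ge0, exprn_ge0).
have push n : (\int[P]_w ((Y w ^+ 2) ^+ n)%:E =
    \int[pushforward P Z]_x (((x : R) ^+ 2) ^+ n)%:E)%E.
  by rewrite ge0_integral_pushforward.
have := push 1%N; under eq_integral do rewrite expr1.
(* For [s = 0] the law is the point mass at [a], and the two sides differ only by the factor
   [moment_const k], which is at least 1. *)
move=> ->; rewrite push; have [s0|s0] := eqVneq s 0.
  have toD n : (\int[pushforward P Z]_x (((x : R) ^+ 2) ^+ n)%:E =
      ((a ^+ 2) ^+ n)%:E)%E.
    rewrite (eq_measure_integral (\d_(a : measurableTypeR R))); last first.
      by move=> A mA _; rewrite [LHS]law// s0 eqxx.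
    by rewrite integral_dirac// diracT mul1e.
  rewrite !toD/= expr1 lee_fin ler_peMl ?moment_const_ge1//.
  by rewrite !(sqr_ge0, exprn_ge0).
have toN n : (\int[pushforward P Z]_x (((x : R) ^+ 2) ^+ n)%:E =
    \int[normal_prob a s]_x ((x ^+ 2) ^+ n)%:E)%E.
  apply: eq_measure_integral => A mA _.
  by rewrite [LHS]law// (negbTE s0).
rewrite !toN; under [in leRHS]eq_integral do rewrite expr1.
exact: normal_moment_le.
Qed.

End gaussian_moments.

(** * Second moment of an integral *)

Section weighted_cauchy_schwarz.
Context d (T : measurableType d) (R : realType).
Variable mu : {measure set T -> \bar R}.

(** On [D] the inverse is the real power of exponent -1, a measurable function. *)
Lemma measurable_fun_inv_gt0 (D : set T) (w : T -> R) :
  measurable_fun D w -> (forall x, D x -> 0 < w x) ->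
  measurable_fun D (fun x => (w x)^-1).
Proof.
move=> mw w0; apply: (eq_measurable_fun (fun x => w x `^ (-1))).
  by move=> x /[!inE] Dx; rewrite powR_inv1// ltW// w0.
exact: (measurableT_comp (measurable_powR (-1)) mw).
Qed.

(** Cauchy-Schwarz for the factors sqrt(w) and f / sqrt(w). If the integral of f^2 / w is infinite
    the bound is trivial; otherwise [B] is its value. *)
Lemma sqr_Rintegral_le (D : set T) (f w : T -> R) (W : R) :
  measurable D -> measurable_fun D f -> measurable_fun D w ->
  (forall x, D x -> 0 < w x) -> (\int[mu]_(x in D) (w x)%:E <= W%:E)%E ->
  0 < W ->
  (((\int[mu]_(x in D) f x) ^+ 2)%:E <=
   W%:E * \int[mu]_(x in D) (f x ^+ 2 / w x)%:E)%E.
Proof.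
move=> mD mf mw w0 intw W0.
have mfw : measurable_fun D (fun x => f x ^+ 2 / w x).
  apply: measurable_funM; first exact: measurable_funX.
  exact: measurable_fun_inv_gt0.
have fw0 x : D x -> 0 <= f x ^+ 2 / w x.
  by move=> Dx; rewrite divr_ge0 ?sqr_ge0// ltW// w0.
case EB : (\int[mu]_(x in D) (f x ^+ 2 / w x)%:E)%E => [B| |]; last 2 first.
- by rewrite gt0_muley ?leey// lte_fin.
- have := integral_ge0 mu (fun x Dx => fw0 x Dx : (0%:E <= (f x ^+ 2 / w x)%:E)%E).
  by rewrite EB.
have iw : mu.-integrable D (EFin \o w).
  apply/integrableP; split; first exact/measurable_EFinP.
  under eq_integral => x /[!inE] Dx do rewrite /= gtr0_norm ?w0//.
  exact: le_lt_trans intw (ltry _).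
have ifw : mu.-integrable D (EFin \o (fun x => f x ^+ 2 / w x)).
  apply/integrableP; split; first exact/measurable_EFinP.
  under eq_integral => x /[!inE] Dx do rewrite /= ger0_norm ?fw0//.
  by rewrite EB ltry.
(* Integrating this Young inequality and optimizing over t gives the result. *)
have young (t : R) x : D x -> 2 * t * f x <= t ^+ 2 * w x + f x ^+ 2 / w x.
  move=> Dx; rewrite -subr_ge0.
  rewrite (_ : _ - _ = (t * w x - f x) ^+ 2 / w x); last by field; rewrite gt_eqF ?w0.
  by rewrite divr_ge0 ?sqr_ge0// ltW// w0.
(* The cases t = 1 and t = -1 of [young] dominate 2 |f| by w + f^2 / w. *)
have if_ : mu.-integrable D (EFin \o f).
  apply: (le_integrable mD _ _ (integrableD mD iw ifw)).
    exact/measurable_EFinP.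
  move=> x Dx; rewrite /= lee_fin.
  rewrite [leRHS]ger0_norm ?addr_ge0 ?fw0 ?(ltW (w0 x Dx))//.
  have := young 1 x Dx; have := young (-1) x Dx; rewrite ler_norml.
  by have := w0 x Dx; have := fw0 x Dx; lra.
set A := Rintegral _ _ _.
have key t : 2 * t * A <= t ^+ 2 * W + B.
  rewrite /A -RintegralZl//.
  apply: (@le_trans _ _ (\int[mu]_(x in D) (t ^+ 2 * w x + f x ^+ 2 / w x))).
    apply: le_Rintegral => //.
    - exact: (integrableZl mD (2 * t) if_).
    - exact: integrableD (integrableZl mD (t ^+ 2) iw) ifw.
    - by move=> x Dx; exact: young.
  rewrite RintegralD//; last exact: (integrableZl mD (t ^+ 2) iw).
  rewrite RintegralZl// {2}/Rintegral EB lerD2r ler_wpM2l ?sqr_ge0//.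
  by rewrite -lee_fin fineK ?integrable_fin_num.
rewrite -EFinM lee_fin.
(* The value [A / W] minimizes t^2 W - 2 t A. *)
have := key (A / W).
rewrite -(ler_pM2l W0).
rewrite [leLHS](_ : _ = 2 * A ^+ 2); last by field; rewrite gt_eqF.
rewrite [leRHS](_ : _ = A ^+ 2 + W * B); last by field; rewrite gt_eqF.
by lra.
Qed.

End weighted_cauchy_schwarz.

(** * Minkowski's integral inequality in L^2 *)

Section second_moment_of_integral.
Context {R : realType}.

(** The integral of a nonnegative function is a supremum over the simple functions below it, so
    monotonicity is an inclusion of index sets. It spares a proof that the squared pathwise integral
    is measurable. *)
Lemma ge0_le_integral_nonmeas d (T : measurableType d)
    (mu : {measure set T -> \bar R}) (f1 f2 : T -> \bar R) :
  (forall x, 0 <= f1 x)%E -> (forall x, f1 x <= f2 x)%E ->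
  (\int[mu]_x f1 x <= \int[mu]_x f2 x)%E.
Proof.
move=> f10 f12; have f20 x : (0 <= f2 x)%E by exact: le_trans (f12 x).
rewrite !ge0_integralTE//; apply: le_ereal_sup => _ [h hf1 <-].
by exists h => // x; exact: le_trans (f12 x).
Qed.

Context d1 d2 (T1 : measurableType d1) (T2 : measurableType d2).
Variables (mu : {sigma_finite_measure set T1 -> \bar R}) (P : probability T2 R).

(** Here sqrt(c) w(u) bounds the L^2 norm of f(u, .). Weighted Cauchy-Schwarz holds for each fixed
    [x]; Tonelli then brings the expectation inside, where E[f^2] / w <= c w integrates to at most
    [c * W]. *)
Lemma expectation_sqr_Rintegral_le (D : set T1) (f : T1 * T2 -> R)
    (w : T1 -> R) (c W : R) :
  measurable D -> measurable_fun (D `*` [set: T2]) f -> measurable_fun D w ->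
  (forall u, D u -> 0 < w u) -> (\int[mu]_(u in D) (w u)%:E <= W%:E)%E ->
  0 < W -> 0 <= c ->
  (forall u, D u -> 'E_P[(fun x => f (u, x) ^+ 2)%R] <= (c * w u ^+ 2)%:E)%E ->
  ('E_P[(fun x => (\int[mu]_(u in D) f (u, x)) ^+ 2)%R] <= (c * W ^+ 2)%:E)%E.
Proof.
move=> mD mf mw w0 intw W0 c0; rewrite unlock => Ef.
pose DT := D `*` [set: T2].
have mDT : measurable DT by exact: measurableX.
(* Extending the integrand by 0 makes it measurable on the whole product, the setting of Tonelli's
   theorem. *)
pose F := (fun z => (f z ^+ 2 / w z.1)%:E) \_ DT.
have wz0 z : DT z -> 0 < w z.1 by move=> [/w0].
have F0 z : (0 <= F z)%E.
  rewrite /F patchE; case: ifPn => // /[!inE] /wz0 wz.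
  by rewrite lee_fin divr_ge0 ?sqr_ge0// ltW.
have mF : measurable_fun [set: T1 * T2] F.
  apply/(measurable_restrictT _ mDT)/measurable_EFinP/measurable_funM.
    exact: measurable_funX.
  apply: measurable_fun_inv_gt0 => //.
  apply: (measurable_comp mD) => //; first by move=> _ [z [Dz _] <-].
  exact: measurable_funTS.
have mfx x : measurable_fun D (fun u => f (u, x)).
  apply: (measurable_comp mDT) => //; first by move=> _ [u Du <-].
  exact/measurable_funTS/pair2_measurable.
have mfu u : D u -> measurable_fun [set: T2] (fun x => f (u, x)).
  by move=> Du; apply: (measurable_comp mDT) => // _ [x _ <-].
have FE x : (\int[mu]_u F (u, x) =
             \int[mu]_(u in D) (f (u, x) ^+ 2 / w u)%:E)%E.
  rewrite [RHS]integral_mkcond; apply: eq_integral => u _.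
  rewrite /F !patchE; case: ifPn => [/[!inE] -[Du _]|/negP uD].
    by rewrite mem_set.
  by rewrite memNset// => Du; apply: uD; rewrite inE.
apply: (@le_trans _ _ (\int[P]_x (W%:E * \int[mu]_u F (u, x)))%E).
  apply: ge0_le_integral_nonmeas => x; first by rewrite lee_fin sqr_ge0.
  by rewrite FE; exact: sqr_Rintegral_le.
rewrite ge0_integralZl//; last 3 first.
- exact: measurable_fun_fubini_tonelli_G.
- by move=> x _; exact: integral_ge0.
- by rewrite lee_fin ltW.
rewrite -(@fubini_tonelli _ _ _ _ _ mu P F mF F0).
have -> : (c * W ^+ 2)%:E = (W%:E * (c%:E * W%:E))%E.
  by rewrite -!EFinM; congr EFin; ring.
rewrite lee_pmul2l//; apply: le_trans (lee_wpmul2l _ intw); last by rewrite lee_fin.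
rewrite -ge0_integralZl//; last 2 first.
- exact/measurable_EFinP.
- by move=> u Du; rewrite lee_fin ltW ?w0.
rewrite [leRHS]integral_mkcond; apply: ge0_le_integral_nonmeas => u.
  exact: integral_ge0.
rewrite patchE; case: ifPn => [/[!inE] Du|uD]; last first.
  rewrite integral0_eq// => x _; rewrite /F patchE ifN//.
  by apply: contra uD; rewrite !inE => -[].
under eq_integral.
  move=> x _; rewrite /F patchE mem_set; last by [].
  rewrite /= mulrC EFinM; over.
rewrite ge0_integralZl//; last 3 first.
- by apply/measurable_EFinP/measurable_funX; exact: mfu.
- by move=> x _; rewrite lee_fin sqr_ge0.
- by rewrite lee_fin invr_ge0 ltW ?w0.
apply: le_trans (lee_wpmul2l _ (Ef u Du)) _.
  by rewrite lee_fin invr_ge0 ltW ?w0.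
rewrite -!EFinM lee_fin expr2 mulrCA mulKf//.
by rewrite gt_eqF ?w0.
Qed.

End second_moment_of_integral.

(** * Variance of the increments *)

Section convex_chord.
Context {R : realType}.

(** The point [u] is the convex combination of 0 and [w] with weights [1 - u / w] and [u / w]. *)
Lemma concave_oppr_chord (F : R -> R) (v u w : R) :
  concave_on `[0, v[ (fun x => - F x) -> 0 <= u -> u < w -> w < v ->
  F u <= (1 - u / w) * F 0 + u / w * F w.
Proof.
move=> cF u0 uw wv; have w0 : 0 < w by exact: le_lt_trans uw.
have t0 : 0 <= 1 - u / w by rewrite subr_ge0 ler_pdivrMr// mul1r ltW.
have t1 : 1 - u / w <= 1 by rewrite gerBl divr_ge0// ltW.
have uE : (1 - u / w) * 0 + (1 - (1 - u / w)) * w = u.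
  by rewrite mulr0 add0r subKr divfK ?gt_eqF.
have := cF (Itv01 t0 t1) 0 w; rewrite !inE/= !in_itv/= lexx (lt_trans w0 wv).
rewrite (ltW w0) wv => /(_ isT isT) H.
rewrite -[F u]opprK -[in leLHS]uE; apply: le_trans H _.
by rewrite convRE/= !opprK /unstable.onem subKr.
Qed.

(** The interval excludes [v], so the chord is drawn from 0 to v - t and t tends to 0 from the
    right. Its right end contributes at most |h(t)|, which vanishes in the limit. *)
Lemma concave_oppr_linear_bound (F h : R -> R) (v : R) :
  concave_on `[0, v[ (fun x => - F x) -> 0 <= F 0 ->
  (forall u, 0 <= u < v -> F u <= h (v - u)) ->
  h x @[x --> 0^'+] --> 0 ->
  forall u, 0 <= u < v -> F u <= (v - u) / v * F 0.
Proof.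
move=> cF F0 Fh h0 u /andP[u0 uv]; have v0 : 0 < v by exact: le_lt_trans uv.
apply/ler_addgt0Pr => e e0.
have vu0 : 0 < v - u by rewrite subr_gt0.
near (0 : R)^'+ => t.
have tvu : t < v - u by near: t; exact: nbhs_right_lt.
have t0 : 0 < t by near: t; exact: nbhs_right_gt.
have hte : `|h t| < e.
  rewrite -normrN -sub0r; near: t; exact: cvgr_dist_lt.
have [uw wv] : u < v - t /\ v - t < v by lra.
have w0 : 0 < v - t by exact: le_lt_trans uw.
apply: (le_trans (concave_oppr_chord cF u0 uw wv)); apply: lerD.
  rewrite ler_wpM2r// mulrBl divff ?gt_eqF// lerB// ler_wpM2l//.
  by rewrite lef_pV2 ?posrE// ltW.
have uw0 : 0 <= u / (v - t) by rewrite divr_ge0// ltW.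
have uw1 : u / (v - t) <= 1 by rewrite ler_pdivrMr// mul1r ltW.
have Fw : F (v - t) <= `|h t|.
  apply: le_trans (Fh _ _) _; first by rewrite ltW.
  by rewrite opprB addrCA subrr addr0 ler_norm.
apply: (@le_trans _ _ `|h t|); last exact: ltW.
apply: le_trans (ler_wpM2l uw0 Fw) _.
by rewrite ler_piMl.
Unshelve. all: by end_near. Qed.

End convex_chord.

(** * Integral of a shifted power *)

Section power_weight.
Context {R : realType}.
Local Notation leb := (@lebesgue_measure R).

Lemma is_derive_powR_shift (p e x : R) : 0 < x + e ->
  is_derive x 1 (fun u : R => (u + e) `^ p) (p * (x + e) `^ (p - 1)).
Proof.
move=> xe0.
have h : is_derive x 1 (fun u : R => u + e) 1.
  by rewrite -[X in is_derive _ _ _ X]addr0; exact: is_deriveD.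
have := @is_derive1_comp _ (fun y => y `^ p) (fun u : R => u + e) x _ _
  (is_derive1_powR _ xe0) h.
by rewrite mulr1.
Qed.

(** Fundamental theorem of calculus: the shift by [e > 0] keeps the integrand continuous up to u = 0
    even when p - 1 is negative. *)
Lemma integral_powR_shift (p e : R) : 0 < p -> 0 < e ->
  (\int[leb]_(u in `[0%R, 1%R]) ((u + e) `^ (p - 1))%:E =
   (p^-1 * ((1 + e) `^ p - e `^ p))%:E)%E.
Proof.
move=> p0 e0.
have xe (x : R) : 0 <= x -> 0 < x + e by move=> x0; rewrite ltr_wpDl.
have cts (q x : R) : 0 <= x -> (u + e) `^ q @[u --> x] --> (x + e) `^ q.
  move=> x0; have [/derivable1_diffP/differentiable_continuous cq _] :=
    is_derive_powR_shift q (xe x x0).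
  exact: cq.
pose F (u : R) := p^-1 * (u + e) `^ p.
have dF (x : R) : 0 <= x -> is_derive x 1 F ((x + e) `^ (p - 1)).
  move=> x0; have := is_derive_powR_shift p (xe x x0) => h.
  rewrite -[X in is_derive _ _ _ X](mulKf (lt0r_neq0 p0)).
  exact: is_deriveZ.
rewrite (@continuous_FTC2 _ _ F)//; first by rewrite /F -EFinB add0r -mulrBr.
- apply/continuous_within_itvP => //; split.
  + move=> x; rewrite in_itv/= => /andP[x0 _]; apply: cts; exact: ltW.
  + by apply: cvg_at_right_filter; exact: cts.
  + by apply: cvg_at_left_filter; apply: cts.
- have cF (x : R) : 0 <= x -> F u @[u --> x] --> F x.
    by move=> x0; apply: cvgM; [exact: cvg_cst|exact: cts].
  split.
  + by move=> x; rewrite in_itv/= => /andP[/ltW x0 _]; case: (dF x x0).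
  + by apply: cvg_at_right_filter; exact: cF.
  + by apply: cvg_at_left_filter; apply: cF.
- move=> x; rewrite in_itv/= => /andP[/ltW x0 _].
  by rewrite derive1E; apply: derive_val; exact: dF.
Qed.

End power_weight.

(** * Pointwise bounds on the variance of an increment, and their integral *)

Section increment_bounds.
Context {R : realType}.
Local Notation leb := (@lebesgue_measure R).

(** The power term carries the concavity bound, and the indicator the crude bound on the last
    stretch, where u + e exceeds 1. That stretch has length [e], so both terms integrate to O(e). *)
Lemma integral_weight_le (p e C H : R) : 0 < p <= 1 -> 0 < e < 1 ->
  0 <= C -> 0 <= H ->
  (\int[leb]_(u in `[0%R, 1%R])
     (C * e * (u + e) `^ (p - 1) + H * \1_(`]1 - e, 1]) u)%:E <=
   ((2 / p * C + H) * e)%:E)%E.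
Proof.
move=> /andP[p0 p1] /andP[e0 e1] C0 H0.
have Ce0 : 0 <= C * e by rewrite mulr_ge0// ltW.
under eq_integral do rewrite EFinD !EFinM.
have mpow : measurable_fun [set: R] (fun u : R => (u + e) `^ (p - 1)).
  by apply: (measurableT_comp (measurable_powR _)); exact: measurable_funD.
rewrite ge0_integralD//=; last 4 first.
- by move=> x _; rewrite -!EFinM lee_fin mulr_ge0// powR_ge0.
- by apply: emeasurable_funM => //; apply/measurable_EFinP/measurable_funTS.
- by move=> x _; rewrite -EFinM lee_fin mulr_ge0.
- by apply: emeasurable_funM => //; exact/measurable_EFinP/measurable_indic.
rewrite !ge0_integralZl//; last 3 first.
- exact/measurable_EFinP/measurable_indic.
- exact/measurable_EFinP/measurable_funTS.
- by move=> x _; rewrite lee_fin powR_ge0.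
rewrite integral_powR_shift// integral_indic// setIidl; last first.
  by move=> x /=; rewrite !in_itv/= => /andP[? ->]; rewrite andbT; lra.
have leb_e : leb `]1 - e, 1] = e%:E.
  by rewrite lebesgue_measure_itv/= lte_fin gtrBl e0 -EFinB subKr.
rewrite [X in (_ + H%:E * X)%E]leb_e -!EFinM -EFinD lee_fin.
(* As p <= 1 and 1 + e >= 1, the first power is at most 1 + e. *)
have pow2 : (1 + e) `^ p - e `^ p <= 2.
  apply: (@le_trans _ _ (1 + e)); last by lra.
  have := powR_ge0 e p; have : (1 + e) `^ p <= (1 + e) `^ 1.
    by apply: ler_powR => //; lra.
  by rewrite powRr1; lra.
rewrite mulrDl lerD2r mulrA (_ : _ * _ * e = C * e / p * 2); last by ring.
by rewrite ler_wpM2l// divr_ge0// ltW.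
Qed.

(** The first bound is the growth of [delta] near 0. The second is the linear bound of a convex
    function at v = u + e, combined with rho(0, v) <= C v^p; it asks for [u <= 1 - e] because
    concavity is given for v <= 1. *)
Lemma increment_bound (rho : R -> R -> R) (delta : R -> R) (p eta : R) :
  0 < p -> 0 < eta -> (forall s t, 0 <= rho s t) ->
  {in `[0, +oo[%classic &, {homo (fun r => delta r ^+ 2) : x y / x <= y}} ->
  (\forall r \near (0 : R)^'+, delta r ^+ 2 <= r `^ p) ->
  (forall s t, 0 <= s <= 1 + eta -> 0 <= t <= 1 + eta ->
     rho s t <= delta `|t - s| ^+ 2) ->
  (forall v, 0 <= v <= 1 -> concave_on `[0, v[ (fun u => - rho u v)) ->
  exists2 C : R, 0 < C & \forall e \near (0 : R)^'+, forall u, 0 <= u <= 1 ->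
    rho u (u + e) <= e `^ p /\
    (u <= 1 - e -> rho u (u + e) <= C * e * (u + e) `^ (p - 1)).
Proof.
move=> p0 eta0 rho0 dinc dp rhod crho.
have [r0 r0_gt0 dr0] : exists2 r0 : R, 0 < r0 &
    forall r, 0 < r -> r < r0 -> delta r ^+ 2 <= r `^ p.
  move: dp => /nbhs_ballP[r0 /= r0_gt0 H]; exists r0 => // r r_gt0 rr0.
  by apply: H => //; rewrite /ball/= sub0r normrN gtr0_norm.
(* Chosen to extend the bound from ]0, r0[ to ]0, 1]: for r >= r0, monotonicity gives delta(r)^2 <=
   delta(1)^2 <= delta(1)^2 (r / r0)^p. *)
pose C := 1 + delta 1 ^+ 2 / r0 `^ p.
have r0p : 0 < r0 `^ p by exact: powR_gt0.
have C1 : 1 <= C by rewrite lerDl divr_ge0 ?sqr_ge0// ltW.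
have dC r : 0 < r -> r <= 1 -> delta r ^+ 2 <= C * r `^ p.
  move=> r_gt0 r_le1; have rp : 0 <= r `^ p by exact: powR_ge0.
  have [rr0|rr0] := ltP r r0.
    by apply: le_trans (dr0 _ r_gt0 rr0) _; rewrite ler_peMl.
  apply: (@le_trans _ _ (delta 1 ^+ 2)).
    by apply: dinc => //; rewrite inE/= in_itv/= ?andbT// ltW.
  rewrite mulrDl mul1r mulrAC -mulrA ler_wpDl// ler_peMr ?sqr_ge0//.
  by rewrite ler_pdivlMr// mul1r ge0_ler_powR ?nnegrE// ltW.
(* The linear bound applies with h(r) = C r^p, and (v - u) / v times C v^p is the right-hand
   side. *)
have ub v : 0 < v <= 1 -> forall u, 0 <= u < v ->
    rho u v <= C * (v - u) * v `^ (p - 1).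
  move=> /andP[v0 v1] u /[dup] uv01 /andP[u0 uv].
  apply: le_trans
    (@concave_oppr_linear_bound _ (rho ^~ v) (fun r => C * r `^ p) v _ _ _ _ u uv01) _.
  - by apply: crho; rewrite (ltW v0).
  - exact: rho0.
  - move=> x /andP[x0 xv]; apply: le_trans (rhod x v _ _) _.
    + by rewrite x0/=; lra.
    + by rewrite (ltW v0)/=; lra.
    + by rewrite ger0_norm ?subr_ge0 ?(ltW xv)// dC; lra.
  - by rewrite -[X in _ --> X](mulr0 C); apply: cvgM; [exact: cvg_cst|exact: powR_cvg0].
  - have : rho 0 v <= C * v `^ p.
      apply: le_trans (rhod 0 v _ _) _.
      + by rewrite lexx/=; lra.
      + by rewrite (ltW v0)/=; lra.
      + by rewrite subr0 gtr0_norm// dC.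
    rewrite -(mulr_powRB1 (ltW v0) p0) => rho0v.
    apply: le_trans (ler_wpM2l _ rho0v) _.
      by rewrite divr_ge0 ?subr_ge0// ltW.
    rewrite le_eqVlt; apply/orP; left; apply/eqP; field.
    by rewrite gt_eqF.
exists C; first exact: lt_le_trans C1.
near=> e => u /andP[u0 u1].
have e0 : 0 < e by near: e; exact: nbhs_right_gt.
have e_eta : e < eta by near: e; exact: nbhs_right_lt.
have uee : u + e - u = e by rewrite addrAC subrr add0r.
split.
  apply: le_trans (rhod u (u + e) _ _) _; [by rewrite u0/=; lra|lra|].
  by rewrite uee gtr0_norm// dr0//; near: e; exact: nbhs_right_lt.
move=> ue; rewrite -[X in C * X * _]uee; apply: ub; lra.
Unshelve. all: by end_near. Qed.

End increment_bounds.

(** * Gaussianity and measurability of the increments *)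

Section increments.
Context {R : realType} d (T : measurableType d) (P : probability T R).

Lemma gaussian_process_increment (I : set R) (X : R -> T -> R) (s t : R) :
  gaussian_process P I X -> I s -> I t ->
  gaussian_variable P (fun x => X t x - X s x).
Proof.
move=> gX Is It.
have := gX 2%N (fun i => if i == ord0 then t else s)
  (fun i => if i == ord0 then 1 else -1).
have -> : (fun x => \sum_(i < 2) (if i == ord0 then 1 else -1) *
    X (if i == ord0 then t else s) x) = (fun x => X t x - X s x).
  by apply/funext => x; rewrite big_ord_recl big_ord1/= mul1r mulN1r.
by apply => i; case: ifP.
Qed.

Lemma canonical_metric2_ge0 (X : R -> T -> R) (s t : R) :
  0 <= canonical_metric2 P X s t.
Proof.
rewrite /canonical_metric2 unlock fine_ge0//.
by apply: integral_ge0 => x _; rewrite lee_fin sqr_ge0.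
Qed.

(** The shift by [e] maps [0, 1] into [0, 1 + eta], where the process is jointly measurable. *)
Lemma measurable_increment_integrand (X : R -> T -> R) (g : R -> R) (m : nat)
    (eta e : R) : 0 <= e <= eta ->
  measurable_fun (`[0, 1 + eta] `*` [set: T] : set (measurableTypeR R * T))
    (fun z : measurableTypeR R * T => X z.1 z.2) ->
  measurable_fun [set: R] g ->
  measurable_fun (`[0, 1] `*` [set: T] : set (measurableTypeR R * T))
    (fun z : measurableTypeR R * T =>
    (X (z.1 + e) z.2 - X z.1 z.2) ^+ m * g ((X (z.1 + e) z.2 + X z.1 z.2) / 2)).
Proof.
move=> /andP[e0 e_eta] mX mg.
have mI : measurable (`[0, 1 + eta] `*` [set: T] : set (measurableTypeR R * T)).
  exact: measurableX.
have mX0 : measurable_fun (`[0, 1] `*` [set: T] : set (measurableTypeR R * T))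
    (fun z : measurableTypeR R * T => X z.1 z.2).
  apply: measurable_funS mX => // -[u x] [/=]; rewrite !in_itv/= => u01 _.
  by split => //; lra.
have mXe : measurable_fun (`[0, 1] `*` [set: T] : set (measurableTypeR R * T))
    (fun z : measurableTypeR R * T => X (z.1 + e) z.2).
  pose shift (z : measurableTypeR R * T) : measurableTypeR R * T :=
    (z.1 + e, z.2).
  apply: (measurable_comp (g := shift) mI _ mX) => /= [_ [[u x] [/= u01 _] <-]|].
    by split => //=; move: u01; rewrite !in_itv/=; lra.
  apply: measurable_funTS; apply: measurable_fun_pair => //.
  exact: measurable_funD.
apply: measurable_funM; first by apply: measurable_funX; exact: measurable_funB.
apply: measurableT_comp => //; apply: measurable_funM => //.
exact: measurable_funD.
Qed.

End increments.

(** * Squeeze between 0 and a multiple of e^(1/m) *)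

Theorem theorem15 (R : realType) (d : measure_display) (T : measurableType d)
  (P : probability T R) (m : nat) (hm : (3 <= m)%N) (hodd : odd m)
  (eta : R) (heta : 0 < eta)
  (X : R -> {RV P >-> R})
  (hgauss : gaussian_process P `[0, 1 + eta] X)
  (hcent : centered P `[0, 1 + eta] X)
  (hmeas : measurable_fun (`[0, 1 + eta] `*` [set: T])
     (fun z : measurableTypeR R * T => X z.1 z.2))
  (delta : R -> R)
  (delta_ge0 : forall r : R, 0 <= r -> 0 <= delta r)
  (delta2_ic : increasing_concave `[0, +oo[ (fun r => delta r ^+ 2))
  (delta_o : delta =o_ ((0 : R)^'+) (fun r : R => r `^ ((2 * m)%N%:R)^-1))
  (metric_le : forall s t : R, 0 <= s <= 1 + eta -> 0 <= t <= 1 + eta ->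
     canonical_metric2 P X s t <= delta `|t - s| ^+ 2)
  (mixed : exists mu : @signed_measure R,
     [/\ total_variation mu (~` offdiag_square) = 0%E,
         mixed_derivative_is open_offdiag_square (canonical_metric2 P X) mu &
         exists C : R, \forall eps \near (0 : R)^'+,
           (total_variation mu
              (gap_region eps)
            <= (C * eps `^ (- ((m%:R - 1) / m%:R)))%:E)%E])
  (Q_ic : increasing_concave `[0, 1] (fun u => cov_fun P X u u))
  (metric_ic_v : forall u : R, 0 <= u <= 1 ->
     increasing_concave `]u, 1] (fun v => canonical_metric2 P X u v))
  (metric_ic_u : forall v : R, 0 <= v <= 1 ->
     increasing_concave `[0, v[ (fun u => - canonical_metric2 P X u v))
  (nondeg : exists a b c c' : R,
     [/\ 1 < a, 0 < b < 2^-1, 4^-1 < c, 0 < c' &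
         \forall eps \near (0 : R)^'+, forall u v : R,
           eps < u -> u < v -> v <= 1 ->
           [/\ c * delta u ^+ 2 <= cov_fun P X u u,
               c' * delta u ^+ 2 * delta (v - u) ^+ 2 <=
                 cov_fun P X u u * cov_fun P X v v - cov_fun P X u v ^+ 2 &
               (delta (a * u) - delta u) / ((a - 1) * u) < b * (delta u / u)]])
  (g : R -> R) (g_meas : measurable_fun [set: R] g) (g_bnd : bounded_fun g) :
  ((eps ^- 2)%:E *
    'E_P[(fun w =>
      (\int[lebesgue_measure]_(u in `[0, 1])
         ((X (u + eps) w - X u w) ^+ m * g ((X (u + eps) w + X u w) / 2)))
      ^+ 2)%R])%E
    @[eps --> (0 : R)^'+] --> 0%E.
Proof.
have m_gt0 : (0 < m)%N by exact: leq_trans hm.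
pose p : R := m%:R^-1.
have p0 : 0 < p by rewrite invr_gt0 ltr0n.
have p1 : p <= 1 by rewrite invf_le1 ?ler1n ?ltr0n.
(* Take constant 1 in the little-o and square: r^(1/(2m)) becomes r^p. *)
have delta_p : \forall r \near (0 : R)^'+, delta r ^+ 2 <= r `^ p.
  move/eqoP : delta_o => /(_ 1 ltr01) delta_o; near=> r.
  have : `|delta r| <= 1 * `|r `^ ((2 * m)%N%:R)^-1| by near: r.
  rewrite mul1r (ger0_norm (powR_ge0 _ _)) => dr.
  rewrite -real_normK ?num_real//.
  have -> : r `^ p = (r `^ ((2 * m)%N%:R)^-1) ^+ 2.
    rewrite -powR_mulrn ?powR_ge0// -powRrM /p natrM invfM mulrAC mulVf//.
    by rewrite mul1r.
  by rewrite lerXn2r ?nnegrE ?powR_ge0.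
have [delta_inc _] := delta2_ic.
have [C C0 incr] := increment_bound p0 heta (canonical_metric2_ge0 P X)
  delta_inc delta_p metric_le (fun v hv => (metric_ic_u v hv).2).
have [M M0 gM] : exists2 M : R, 0 < M & forall x, `|g x| <= M.
  have /pinfty_ex_gt0[M M0 gM] := g_bnd.
  by exists M => // x; exact: gM.
(* This dominates 2 C / p + e^p for e <= 1. In [c] below, [M ^+ 2] comes from the bound on [g], and
   [moment_const m] from the moment of order 2 m of an increment. *)
pose L := 2 / p * C + 1.
pose c := M ^+ 2 * moment_const m.
have c0 : 0 <= c.
  by rewrite mulr_ge0 ?sqr_ge0// (le_trans ler01)// moment_const_ge1.
pose bnd (e : R) : \bar R := (c * L ^+ 2 * e `^ p)%:E.
have bnd0 : bnd e @[e --> (0 : R)^'+] --> 0%E.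
  apply: cvg_EFin; first by near=> e.
  rewrite -[X in _ --> X](mulr0 (c * L ^+ 2)); apply: cvgM; first exact: cvg_cst.
  exact: powR_cvg0.
apply: (squeeze_cvge _ (cvg_cst 0%E) bnd0); near=> e.
have e0 : 0 < e by near: e; exact: nbhs_right_gt.
have e1 : e < 1 by near: e; exact: nbhs_right_lt.
have e_eta : e < eta by near: e; exact: nbhs_right_lt.
have incr_e : forall u, 0 <= u <= 1 ->
    canonical_metric2 P X u (u + e) <= e `^ p /\
    (u <= 1 - e ->
     canonical_metric2 P X u (u + e) <= C * e * (u + e) `^ (p - 1)).
  by near: e.
apply/andP; split.
  rewrite mule_ge0 ?lee_fin ?invr_ge0 ?sqr_ge0// unlock.
  by apply: integral_ge0 => x _; rewrite lee_fin sqr_ge0.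
pose H := e `^ p.
have H0 : 0 < H by exact: powR_gt0.
have H1 : H <= 1.
  have := @ge0_ler_powR R p (ltW p0) e 1; rewrite powR1; apply.
  - by rewrite nnegrE ltW.
  - by rewrite nnegrE.
  - exact: ltW.
(* The square root makes [h ^+ (m - 2)] the power (m - 2)/2 of the uniform variance bound [H]. *)
pose h := Num.sqrt H.
have h0 : 0 < h by rewrite sqrtr_gt0.
have h1 : h <= 1 by rewrite -sqrtr1 ler_wsqrtr.
have hH : h ^+ 2 = H by rewrite sqr_sqrtr// ltW.
(* [b] bounds the variance of the increment at [u], [w] its power m/2, and [W] the integral of
   [w]. *)
pose b u := C * e * (u + e) `^ (p - 1) + H * \1_(`]1 - e, 1]) u.
pose w u := h ^+ (m - 2) * b u.
pose W := h ^+ (m - 2) * ((2 / p * C + H) * e).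
have pow0 u : 0 <= u -> 0 < (u + e) `^ (p - 1).
  by move=> u0; rewrite powR_gt0// ltr_wpDl.
have b0 u : 0 <= u -> 0 < b u.
  move=> u0; apply: ltr_wpDr; first by rewrite mulr_ge0 ?(ltW H0).
  by rewrite mulr_gt0 ?pow0// mulr_gt0.
have mb : measurable_fun [set: R] b.
  apply: measurable_funD; apply: measurable_funM => //.
  by apply: (measurableT_comp (measurable_powR _)); exact: measurable_funD.
have L0 : 0 < 2 / p * C + H by rewrite addr_gt0// mulr_gt0// divr_gt0.
have W0 : 0 < W by rewrite mulr_gt0 ?exprn_gt0// mulr_gt0.
(* Since m - 2 >= 1 and h <= 1, one factor [h] survives; squared, it is the [H] that tends to 0. *)
have WL : W ^+ 2 <= H * L ^+ 2 * e ^+ 2.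
  have WhLe : W <= h * (L * e).
    apply: ler_pM; rewrite ?exprn_ge0 ?(ltW h0) ?(ltW (mulr_gt0 L0 e0))//.
      rewrite (_ : (m - 2)%N = (m - 3).+1); last by rewrite -subSn.
      by rewrite exprS ler_piMr ?(ltW h0)// exprn_ile1// ltW.
    by rewrite ler_wpM2r ?(ltW e0)// lerD2l.
  rewrite -hH -!exprMn lerXn2r ?nnegrE -?mulrA ?(ltW W0)//.
  exact: le_trans (ltW W0) WhLe.
have EW : ('E_P[(fun x => (\int[lebesgue_measure]_(u in `[0%R, 1%R])
    ((X (u + e) x - X u x) ^+ m * g ((X (u + e) x + X u x) / 2))) ^+ 2)%R]
    <= (c * W ^+ 2)%:E)%E.
  have e_eta' : 0 <= e <= eta by rewrite !ltW.
  have mF := measurable_increment_integrand (X := fun u x => X u x) m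
    e_eta' hmeas g_meas.
  have Q := @expectation_sqr_Rintegral_le R _ _ _ _ lebesgue_measure P _ _ w c W _ mF.
  apply: Q => //.
  - by apply: measurable_funTS; exact: measurable_funM.
  - move=> u /=; rewrite in_itv/= => /andP[u0 _].
    by rewrite mulr_gt0 ?exprn_gt0// b0.
  - rewrite /w /W EFinM.
    under eq_integral do rewrite EFinM.
    rewrite ge0_integralZl//; last 3 first.
    + by apply/measurable_EFinP; exact: measurable_funTS.
    + by move=> u /=; rewrite in_itv/= => /andP[u0 _]; rewrite lee_fin ltW ?b0.
    + by rewrite lee_fin exprn_ge0 ?ltW.
    rewrite lee_wpmul2l ?lee_fin ?exprn_ge0 ?(ltW h0)//.
    by apply: integral_weight_le; rewrite ?p0 ?e0 ?(ltW C0) ?(ltW H0).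
  - move=> u /=; rewrite in_itv/= => u01; have /andP[u0 u1] := u01.
    set K := canonical_metric2 P X u (u + e).
    have K0 : 0 <= K by exact: canonical_metric2_ge0.
    have [KH Kpow] := incr_e u u01.
    have Kb : K <= b u.
      have [ue|ue] := leP u (1 - e).
        apply: le_trans (Kpow ue) _.
        by rewrite lerDl mulr_ge0// ltW.
      apply: le_trans KH _.
      rewrite /b indicE mem_set ?mulr1; last by rewrite /= in_itv/= ue.
      by rewrite lerDr mulr_ge0 ?(ltW (pow0 u u0))// mulr_ge0// ltW.
    (* Write K^m = K^(m-2) K^2 and use K <= H in the first factor, K <= b(u) in the second. *)
    have Kw : K ^+ m <= w u ^+ 2.
      rewrite -[in leLHS](subnK (ltnW hm)) exprD /w exprMn exprAC hH.
      apply: ler_pM; rewrite ?exprn_ge0//.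
        by rewrite lerXn2r ?nnegrE ?(ltW H0).
      by rewrite lerXn2r ?nnegrE// ltW// b0.
    have gau : gaussian_variable P (fun x => X (u + e) x - X u x).
      by apply: (gaussian_process_increment hgauss); rewrite /= in_itv/=; lra.
    have mG : measurable_fun [set: T] (fun x => X (u + e) x - X u x).
      exact: measurable_funB.
    apply: (@le_trans _ _ ((M ^+ 2)%:E *
        'E_P[(fun x => ((X (u + e) x - X u x) ^+ 2) ^+ m)%R])%E).
      rewrite unlock -ge0_integralZl//; last 3 first.
      + by apply/measurable_EFinP; do 2 apply: measurable_funX.
      + by move=> x _; rewrite lee_fin !(sqr_ge0, exprn_ge0).
      + by rewrite lee_fin sqr_ge0.
      apply: ge0_le_integral_nonmeas => x; first by rewrite lee_fin sqr_ge0.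
      rewrite -EFinM lee_fin exprMn exprAC mulrC.
      rewrite ler_wpM2r ?(sqr_ge0, exprn_ge0)// -real_normK ?num_real//.
      by rewrite lerXn2r ?nnegrE ?(ltW M0).
    apply: le_trans (lee_wpmul2l _ (gaussian_moment_le m mG gau)) _.
      by rewrite lee_fin sqr_ge0.
    rewrite -EFinM lee_fin mulrA -/c ler_wpM2l//.
(* The factor e^2 in the bound on W^2 cancels the normalization, leaving c L^2 e^p. *)
apply: le_trans (lee_wpmul2l _ EW) _.
  by rewrite lee_fin invr_ge0 sqr_ge0.
rewrite -EFinM lee_fin mulrC ler_pdivrMr ?exprn_gt0//.
rewrite [leRHS](_ : _ = c * (H * L ^+ 2 * e ^+ 2)); last by rewrite /H; ring.
by rewrite ler_wpM2l.
Unshelve. all: by end_near.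
Qed.
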